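(* Let $R$ be a commutative noetherian ring of prime characteristic $p>0$, let $I,\mathfrak{a}\subset R$ be ideals, and let $t\in\mathbb{R}_{>0}$. (a) We have $I^{F\mathfrak{a}}\subset(I^F:\mathfrak{a})$, and the inclusion is an equality if $\mathfrak{a}$ is a principal ideal. In particular, if $\mathfrak{a}=(f)$, then $(I^{F\mathfrak{a}})^{F\mathfrak{a}}\ne I^{F\mathfrak{a}}$ when $(R,\mathfrak{m})$ is local, $I$ is $\mathfrak{m}$-primary, and $f\in\mathfrak{m}\setminus I^F$. (b) If $\mathfrak{a}=(f)$ is a principal ideal and $f$ is a non-zerodivisor on $R$, then ${}^{\mathfrak{a}^t}I^F=I^F$. (c) If $t>\mu(\mathfrak{a})$, then (i) $I^{F\mathfrak{a}^t}=(I^{F\mathfrak{a}^{t-1}}:\mathfrak{a})$, and (ii) ${}^{\mathfrak{a}^t}I^F=({}^{\mathfrak{a}^{t-1}}(\mathfrak{a}I)^F:\mathfrak{a})$. (d) If $\mathfrak{a}\subset\sqrt{0}$, then for all ideals $I\subset R$ and all $t\in\mathbb{R}_{>0}$ we have ${}^{\mathfrak{a}^t}I^F=R$.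
   Context: All rings are commutative with unit and noetherian. $I^{[p^e]}$ is the ideal generated by $\{r^{p^e}\mid r\in I\}$. The Frobenius closure of $I$ is $I^F=\{x\in R\mid x^{p^e}\in I^{[p^e]}\text{ for some }e\in\mathbb{N}\}$. The Hara-Yoshida and Vraciu $\mathfrak{a}^t$-Frobenius closures are $$I^{F\mathfrak{a}^t}=\{x\in R\mid\text{for all }e\gg0,\ x^{p^e}\mathfrak{a}^{\lceil tp^e\rceil}\subset I^{[p^e]}\},$$ $${}^{\mathfrak{a}^t}I^F=\{x\in R\mid\text{for all }e\gg0,\ x^{p^e}\mathfrak{a}^{\lceil tp^e\rceil}\subset\mathfrak{a}^{\lceil tp^e\rceil}I^{[p^e]}\}.$$ $I^{F\mathfrak{a}}$ means $I^{F\mathfrak{a}^t}$ with $t=1$; with superscript $\mathfrak{a}^{t-1}$ the ideal is $\mathfrak{a}$ and the real parameter is $t-1$. Non-positive powers of ideals are interpreted as the entire ring. $\mu(\mathfrak{a})$ is the minimal number of generators of $\mathfrak{a}$. *)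

(* Defs.v *)
From HB Require Import structures.
From mathcomp Require Import all_boot all_order all_algebra.
From mathcomp Require Import boolp classical_sets filter reals.

Set Implicit Arguments.
Unset Strict Implicit.
Unset Printing Implicit Defensive.

Import Order.TTheory GRing.Theory Num.Theory.
Local Open Scope classical_set_scope.
Local Open Scope ring_scope.

Section Ideals.
Context {R : comNzRingType}.
Implicit Types (I J M S : set R) (a x y : R).

(* The boolean [idealr_closed] of MathComp only covers proper ideals, whereas
   the unit ideal has to be allowed here. *)
Definition is_ideal I : Prop :=
  [/\ I 0, forall x y, I x -> I y -> I (x + y) & forall a x, I x -> I (a * x)].

Definition ideal_gen S : set R := smallest is_ideal S.

Definition principal I : Prop := exists f : R, I = ideal_gen [set f].

Definition generated_by_n I (n : nat) : Prop :=
  exists s : seq R, size s = n /\ I = ideal_gen [set` s].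

(* The minimal number of generators; the default value 0 is only used for
   ideals that are not finitely generated. *)
Definition mu I : nat :=
  xget 0%N [set n | generated_by_n I n /\
                    forall k, generated_by_n I k -> (n <= k)%N].

Definition ideal_mul I J : set R :=
  ideal_gen [set z | exists x y, [/\ I x, J y & z = x * y]].

Definition ideal_exp I (n : nat) : set R := iter n (ideal_mul I) setT.

Definition ideal_expz I (n : int) : set R :=
  match n with Posz k => ideal_exp I k | Negz _ => setT end.

Definition ideal_colon I J : set R := [set x | forall y, J y -> I (x * y)].

Definition ideal_radical I : set R := [set x | exists n : nat, I (x ^+ n)].

Definition maximal_ideal M : Prop :=
  [/\ is_ideal M, M <> setT &
      forall J, is_ideal J -> M `<=` J -> J <> setT -> J = M].

Definition primary_ideal I : Prop :=
  [/\ is_ideal I, I <> setT &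
      forall x y, I (x * y) -> I x \/ exists n : nat, I (y ^+ n)].

(* [M]-primary: primary with radical [M]. *)
Definition primary_to M I : Prop := primary_ideal I /\ ideal_radical I = M.

Definition frobenius_power (p e : nat) I : set R :=
  ideal_gen [set r ^+ (p ^ e) | r in I].

Definition frobenius_closure (p : nat) I : set R :=
  [set x | exists e : nat, frobenius_power p e I (x ^+ (p ^ e))].

End Ideals.

Definition noetherian (R : comNzRingType) : Prop :=
  forall I : set R, is_ideal I -> exists n, generated_by_n I n.

Definition is_local_ring (R : comNzRingType) (M : set R) : Prop :=
  maximal_ideal M /\ forall N : set R, maximal_ideal N -> N = M.

Section FrobeniusClosures.
Context {K : realType} {R : comNzRingType}.
Implicit Types (a I : set R) (t : K).

(* a ^ (ceil (t * p ^ e)) *)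
Definition ceil_power (p : nat) a t (e : nat) : set R :=
  ideal_expz a (Num.ceil (t * (p ^ e)%:R)).

(* I ^ (F a^t), due to Hara and Yoshida *)
Definition hy_closure (p : nat) a t I : set R :=
  [set x | \forall e \near \oo,
     [set x ^+ (p ^ e) * y | y in ceil_power p a t e]
       `<=` frobenius_power p e I].

(* ^(a^t) I ^ F, due to Vraciu *)
Definition vraciu_closure (p : nat) a t I : set R :=
  [set x | \forall e \near \oo,
     [set x ^+ (p ^ e) * y | y in ceil_power p a t e]
       `<=` ideal_mul (ceil_power p a t e) (frobenius_power p e I)].

End FrobeniusClosures.

(* Main.v *)
Require Import Defs.
From HB Require Import structures.
From mathcomp Require Import all_boot all_order all_algebra.
From mathcomp Require Import boolp classical_sets filter reals.

Set Implicit Arguments.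
Unset Strict Implicit.
Unset Printing Implicit Defensive.

Import Order.TTheory GRing.Theory Num.Theory.
Local Open Scope classical_set_scope.
Local Open Scope ring_scope.

(** Write [q] for [p ^ e] and [n] for the rounded-up value of [t * q].

    Frobenius is additive, so the elements whose [q]-th power lies in a given
    ideal form an ideal ([is_ideal_frobenius_preim]).  Hence an inclusion of
    [x ^ q * A] in an ideal, for all [x] in an ideal [M], need only be tested on
    generators of [M] and [A], and the membership of [x ^ q] in [I^[q]] persists
    for all larger [q].  For a principal
    ideal [a = (f)] the power [a ^ n] is [(f ^ n)], and parts (a) and (b) reduce
    to elementary manipulations with the one element [f].  For the failure of
    idempotence, put [J = (I^F : f)]; if the closure fixed [J], then
    [(I^F : f ^ 2) <= (I^F : f)], hence [(I^F : f ^ n) <= (I^F : f)] for all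
    [n > 0], and since some power of [f] lies in [I], [f] would lie in [I^F].

    Parts (c) and (d) rest on a pigeonhole argument ([ideal_exp_pigeonhole]):
    if [a] has [m] generators and [n > m * (q - 1)], every monomial of degree
    [n] in the generators is divisible by the [q]-th power of one of them, so
    [a ^ n] is contained in the sum of the ideals [g ^ q * a ^ (n - q)] over
    the generators [g], that is, in [a^[q] * a ^ (n - q)].  The reverse
    inclusion always holds.  When [t > mu a], the exponent [n] is large enough,
    and [n - q] is the exponent attached to [t - 1]; the resulting equality
    [a ^ n = a^[q] * a ^ (n - q)] is what moves a factor [a] between the
    closure and the colon.  When [a] is nil, a [k] that kills the [k]-th power
    of every generator plays the role of [q], and [a ^ n = 0] for large [n]. *)

(** * Ideals and their generators *)

Section IdealTheory.
Context {R : comNzRingType}.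
Implicit Types (I J M S T : set R) (a x y f g : R).

Lemma is_ideal_gen S : is_ideal (ideal_gen S).
Proof.
split=> [J [[J0 _ _] _] // |x y Sx Sy J [Ji SJ]|a x Sx J [Ji SJ]].
- case: (Ji) => _ JD _; apply: JD; [exact: Sx|exact: Sy].
- by case: (Ji) => _ _ JM; apply: JM; exact: Sx.
Qed.

Lemma mem_ideal_gen S x : S x -> ideal_gen S x.
Proof. by move=> Sx J [_ SJ]; exact: SJ. Qed.

Lemma ideal_gen_sub {S J} : is_ideal J -> S `<=` J -> ideal_gen S `<=` J.
Proof. by move=> Ji SJ x; apply. Qed.

Lemma ideal0 {J} : is_ideal J -> J 0. Proof. by case. Qed.

Lemma idealMl {J} a {x} : is_ideal J -> J x -> J (a * x).
Proof. by case=> _ _; apply. Qed.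

Lemma idealMr {J} a {x} : is_ideal J -> J x -> J (x * a).
Proof. by move=> Ji Jx; rewrite mulrC; exact: idealMl. Qed.

Lemma is_ideal_set0 : is_ideal [set 0 : R].
Proof.
by split=> // [x y -> ->|a x ->] /=; rewrite ?addr0 ?mulr0.
Qed.

Lemma is_ideal_setT : is_ideal [set: R].
Proof. by []. Qed.

Lemma is_ideal_colon I J : is_ideal I -> is_ideal (ideal_colon I J).
Proof.
move=> Ii; split=> [y _|x y Ix Iy z Jz|a x Ix z Jz].
- by rewrite mul0r; exact: ideal0.
- by rewrite mulrDl; case: Ii => _ + _; apply; [exact: Ix|exact: Iy].
- by rewrite -mulrA; apply: idealMl => //; exact: Ix.
Qed.

Lemma is_ideal_mull_preim J y : is_ideal J -> is_ideal [set x | J (y * x)].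
Proof.
move=> Ji; split=> [|x z Jx Jz|a x Jx] /=.
- by rewrite mulr0; exact: ideal0.
- by rewrite mulrDr; case: Ji => _ + _; apply.
- by rewrite mulrCA; exact: idealMl.
Qed.

Lemma ideal_gen1P f x : ideal_gen [set f] x <-> exists r, x = r * f.
Proof.
split=> [|[r ->]]; last first.
  by apply: (idealMl r (is_ideal_gen _)); exact: mem_ideal_gen.
apply: (@ideal_gen_sub _ [set x | exists r, x = r * f]).
- split=> [|_ _ [r ->] [s ->]|b _ [r ->]].
  + by exists 0; rewrite mul0r.
  + by exists (r + s); rewrite mulrDl.
  + by exists (b * r); rewrite mulrA.
- by move=> _ ->; exists 1; rewrite mul1r.
Qed.

Lemma colon_gen1P J f x :
  is_ideal J -> ideal_colon J (ideal_gen [set f]) x <-> J (x * f).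
Proof.
move=> Ji; split=> [|Jxf y /ideal_gen1P[r ->]].
  by apply; exact: mem_ideal_gen.
by rewrite mulrCA; exact: idealMl.
Qed.

Lemma mu_generators I : noetherian R -> is_ideal I ->
  exists s : seq R, size s = mu I /\ I = ideal_gen [set` s].
Proof.
move=> noethR /noethR[n In].
have ex_gen : exists n, `[< generated_by_n I n >] by exists n; apply/asboolP.
suff [] : [set n | generated_by_n I n /\
    forall k, generated_by_n I k -> (n <= k)%N] (mu I) by [].
apply: (@xgetPex _ 0%N); case: (ex_minnP ex_gen) => m /asboolP Im min_m.
by exists m; split=> // k Ik; apply: min_m; apply/asboolP.
Qed.

(** * Products and powers of ideals *)

Lemma is_ideal_mul I J : is_ideal (ideal_mul I J).
Proof. exact: is_ideal_gen. Qed.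

Lemma mem_ideal_mul I J x y : I x -> J y -> ideal_mul I J (x * y).
Proof. by move=> Ix Jy; apply: mem_ideal_gen; exists x, y. Qed.

Lemma ideal_mul_sub I J M : is_ideal M ->
  (forall x y, I x -> J y -> M (x * y)) -> ideal_mul I J `<=` M.
Proof.
by move=> Mi IJM; apply: ideal_gen_sub => // _ [x [y [Ix Jy ->]]]; exact: IJM.
Qed.

Lemma ideal_mul_gen_sub S T M : is_ideal M ->
  (forall x y, S x -> T y -> M (x * y)) ->
  ideal_mul (ideal_gen S) (ideal_gen T) `<=` M.
Proof.
move=> Mi STM; apply: ideal_mul_sub => // x y Sx Ty.
pose M1 := [set y | forall x, S x -> M (x * y)].
have M1i : is_ideal M1.
  split=> [z _|u v Mu Mv z Sz|b u Mu z Sz].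
  - by rewrite mulr0; exact: ideal0.
  - by rewrite mulrDr; case: Mi => _ + _; apply; [exact: Mu|exact: Mv].
  - by rewrite mulrCA; apply: idealMl => //; exact: Mu.
have M1y : M1 y by apply: ideal_gen_sub Ty => // v Tv u Su; exact: STM.
rewrite mulrC; apply: (ideal_gen_sub (is_ideal_mull_preim y Mi)) Sx.
by move=> z Sz /=; rewrite mulrC; exact: M1y.
Qed.

Lemma ideal_expS I n : ideal_exp I n.+1 = ideal_mul I (ideal_exp I n).
Proof. by []. Qed.

Lemma is_ideal_exp I n : is_ideal (ideal_exp I n).
Proof. by case: n => [|n]; [exact: is_ideal_setT|exact: is_ideal_mul]. Qed.

Lemma ideal_exp_le I m n : (m <= n)%N -> ideal_exp I n `<=` ideal_exp I m.
Proof.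
elim: n m => [|n IHn] [|m] // le_mn.
rewrite !ideal_expS; apply: ideal_mul_sub; first exact: is_ideal_mul.
by move=> x y Ix In; apply: mem_ideal_mul => //; exact: IHn In.
Qed.

Lemma mem_ideal_expM I g m n z :
  I g -> ideal_exp I n z -> ideal_exp I (m + n) (g ^+ m * z).
Proof.
move=> Ig Iz; elim: m => [|m IHm]; first by rewrite mul1r.
by rewrite addSn ideal_expS exprS -mulrA; exact: mem_ideal_mul.
Qed.

(** This also covers [n < q], where the exponent [n - q] is truncated to [0]
    and [g ^ q] alone lies in [I ^ q <= I ^ n]; that matches the convention
    for non-positive powers. *)
Lemma mem_ideal_exp_subM I g q n z :
  I g -> ideal_exp I (n - q) z -> ideal_exp I n (g ^+ q * z).
Proof.
move=> Ig Iz; apply: (@ideal_exp_le _ _ (q + (n - q))).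
  by rewrite -leq_subLR.
exact: mem_ideal_expM.
Qed.

Lemma ideal_exp_gen1P f n x :
  ideal_exp (ideal_gen [set f]) n x <-> exists r, x = r * f ^+ n.
Proof.
split=> [|[r ->]]; last first.
  apply: (idealMl r (is_ideal_exp _ _)); rewrite -[f ^+ n]mulr1.
  by apply: mem_ideal_exp_subM; [exact: mem_ideal_gen|rewrite subnn].
elim: n x => [|n IHn] x; first by exists x; rewrite mulr1.
move=> fx; apply/ideal_gen1P; move: x fx.
apply: ideal_mul_sub; first exact: is_ideal_gen.
move=> y z /ideal_gen1P[r ->] /IHn[s ->].
by apply/ideal_gen1P; exists (r * s); rewrite exprS mulrACA.
Qed.

Lemma prod_ideal_exp I (w : seq R) :
  (forall g, g \in w -> I g) -> ideal_exp I (size w) (\prod_(g <- w) g).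
Proof.
elim: w => [|g w IHw] // Iw; rewrite big_cons; apply: mem_ideal_mul.
  by apply: Iw; rewrite mem_head.
by apply: IHw => h hw; apply: Iw; rewrite inE hw orbT.
Qed.

Lemma ideal_exp_gen (s : seq R) n :
  ideal_exp (ideal_gen [set` s]) n `<=`
  ideal_gen [set z | exists w : seq R,
    [/\ size w = n, {subset w <= s} & z = \prod_(g <- w) g]].
Proof.
elim: n => [|n IHn].
  move=> x _; rewrite -[x]mulr1; apply: (idealMl x (is_ideal_gen _)).
  by apply: mem_ideal_gen; exists [::]; split=> //; rewrite big_nil.
rewrite ideal_expS; set T := [set z | exists _, _] in IHn.
have sub : ideal_mul (ideal_gen [set` s]) (ideal_exp (ideal_gen [set` s]) n)
    `<=` ideal_mul (ideal_gen [set` s]) (ideal_gen T).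
  apply: ideal_mul_sub; first exact: is_ideal_mul.
  by move=> u v su /IHn; exact: mem_ideal_mul.
apply: (subset_trans sub); apply: ideal_mul_gen_sub; first exact: is_ideal_gen.
move=> g _ /= gs [w [sw ws ->]]; apply: mem_ideal_gen.
exists (g :: w); split; rewrite /= ?sw ?big_cons // => h.
by rewrite inE => /orP[/eqP->//|/ws].
Qed.

End IdealTheory.

(** * Pigeonhole for powers of a finitely generated ideal *)

Lemma size_le_mul_count {T : eqType} (s w : seq T) k : {subset w <= s} ->
  (forall g, g \in s -> (count_mem g w <= k)%N) -> (size w <= size s * k)%N.
Proof.
elim: s w => [|g s IHs] w ws wk.
  by case: w ws {wk} => // h w /(_ h (mem_head _ _)).
rewrite -(count_predC (pred1 g)) mulSn leq_add ?wk ?mem_head //.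
rewrite -size_filter; apply: IHs => [h|h hs].
  by rewrite mem_filter => /andP[/= /negPf gh /ws]; rewrite inE gh.
apply: leq_trans (wk h _); last by rewrite inE hs orbT.
by rewrite count_filter; apply: sub_count => x /= /andP[].
Qed.

Section Pigeonhole.
Context {R : comNzRingType}.
Implicit Types (I J : set R).

Lemma prod_count_mem (w : seq R) g q : (q <= count_mem g w)%N ->
  exists w', [/\ size w' = (size w - q)%N, {subset w' <= w} &
                 \prod_(h <- w) h = g ^+ q * \prod_(h <- w') h].
Proof.
move=> qw; pose w' := nseq (count_mem g w - q) g ++ [seq h <- w | predC1 g h].
have Ew : perm_eq w (nseq q g ++ w').
  rewrite catA -nseqD subnKC //.
  have -> : nseq (count_mem g w) g = [seq h <- w | pred1 g h].
    by rewrite -size_filter; apply/esym/all_pred1P; exact: filter_all.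
  by rewrite perm_sym; apply/permPl; exact: perm_filterC.
exists w'; split.
- by rewrite (perm_size Ew) size_cat size_nseq addKn.
- by move=> h hw'; rewrite (perm_mem Ew) mem_cat hw' orbT.
- by rewrite (perm_big _ Ew) big_cat big_nseq iter_mulr_1.
Qed.

(** A monomial of degree [n > size s * (q - 1)] in the entries of [s] contains
    some entry at least [q] times.  The conclusion says that [a ^ n] lies in
    the sum of the [g ^ q * a ^ (n - q)]; stating it through an arbitrary [J]
    avoids handling that sum. *)
Lemma ideal_exp_pigeonhole (s : seq R) q n J : is_ideal J ->
  (size s * q.-1 < n)%N ->
  (forall g z, g \in s -> ideal_exp (ideal_gen [set` s]) (n - q) z ->
     J (g ^+ q * z)) ->
  ideal_exp (ideal_gen [set` s]) n `<=` J.
Proof.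
move=> Ji lt_n sJ; apply: subset_trans (@ideal_exp_gen _ s n) _.
apply: ideal_gen_sub => // _ [w [sw ws ->]].
have /hasP[g gs qg] : has (fun g => q <= count_mem g w)%N s.
  apply/negPn/negP; rewrite -all_predC => /allP nq; move: lt_n.
  rewrite ltnNge -sw (size_le_mul_count ws) // => g /nq /=.
  by rewrite -ltnNge; case: q {sJ nq}.
have [w' [sw' w'w ->]] := prod_count_mem qg.
apply: sJ => //; rewrite -sw -sw'; apply: prod_ideal_exp => h /w'w /ws hs.
exact: mem_ideal_gen.
Qed.

Lemma bounded_exponents (s : seq R) (P : R -> nat -> Prop) :
  (forall g, g \in s -> exists N, forall e, (N <= e)%N -> P g e) ->
  exists N, forall g e, g \in s -> (N <= e)%N -> P g e.
Proof.
elim: s => [|g s IHs] sP; first by exists 0%N.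
have [M gP] := sP g (mem_head _ _).
have [|N IH] := IHs; first by move=> h hs; apply: sP; rewrite inE hs orbT.
exists (maxn M N) => h e; rewrite inE geq_max => /orP[/eqP-> | hs] /andP[Me Ne].
  exact: gP.
exact: IH.
Qed.

Lemma ideal_exp_nil (s : seq R) :
  ideal_gen [set` s] `<=` ideal_radical [set 0] ->
  exists N, forall n, (N <= n)%N ->
    ideal_exp (ideal_gen [set` s]) n `<=` [set 0].
Proof.
move=> nil_s; have [|k sk] := @bounded_exponents s (fun g k => g ^+ k = 0).
  move=> g gs; have [k gk] := nil_s g (@mem_ideal_gen _ [set` s] g gs).
  by exists k => e /subnKC<-; rewrite exprD gk mul0r.
exists (size s * k.-1).+1 => n lt_n.
apply: (@ideal_exp_pigeonhole _ k) => //; first exact: is_ideal_set0.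
by move=> g z gs _ /=; rewrite sk ?mul0r.
Qed.

End Pigeonhole.

(** * Frobenius powers *)

Section Frobenius.
Context {R : comNzRingType} {p : nat} (charRp : p \in [pchar R]).
Implicit Types (I J a : set R) (e k : nat).

Lemma is_ideal_frobenius_preim J e :
  is_ideal J -> is_ideal [set x | J (x ^+ (p ^ e))].
Proof.
have p_pr : prime p by exact: pcharf_prime charRp.
have charq : [pchar R].-nat (p ^ e)%N by rewrite pnatX pnatE ?charRp.
move=> Ji; split=> [|x y Jx Jy|b x Jx] /=.
- by rewrite expr0n expn_eq0 eqn0Ngt prime_gt0 //; exact: ideal0.
- by rewrite exprDn_pchar //; case: Ji => _ + _; apply.
- by rewrite exprMn; exact: idealMl.
Qed.

Lemma mem_frobenius_power e I r : I r -> frobenius_power p e I (r ^+ (p ^ e)).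
Proof. by move=> Ir; apply: mem_ideal_gen; exists r. Qed.

Lemma frobenius_powerX e k I x : frobenius_power p e I x ->
  frobenius_power p (e + k) I (x ^+ (p ^ k)).
Proof.
apply: (ideal_gen_sub (is_ideal_frobenius_preim k (is_ideal_gen _))).
move=> _ [r Ir <-] /=; rewrite -exprM -expnD; exact: mem_frobenius_power.
Qed.

Lemma frobenius_closureP I x : frobenius_closure p I x <->
  exists N, forall e, (N <= e)%N -> frobenius_power p e I (x ^+ (p ^ e)).
Proof.
split=> [[N xN]|[N xN]]; last by exists N; exact: xN.
by exists N => e /subnKC<-; rewrite expnD exprM; exact: frobenius_powerX.
Qed.

Lemma is_ideal_frobenius_closure I : is_ideal (frobenius_closure p I).
Proof.
split=> [|x y /frobenius_closureP[M xM] /frobenius_closureP[N yN]|b x [e xe]].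
- exists 0%N; rewrite expn0 expr1; exact/ideal0/is_ideal_gen.
- have PI : is_ideal (frobenius_power p (maxn M N) I) by exact: is_ideal_gen.
  exists (maxn M N).
  have [_ + _] := is_ideal_frobenius_preim (maxn M N) PI; apply => /=.
    by apply: xM; exact: leq_maxl.
  by apply: yN; exact: leq_maxr.
- by exists e; rewrite exprMn; exact: (idealMl _ (is_ideal_gen _)).
Qed.

Lemma sub_frobenius_closure I : I `<=` frobenius_closure p I.
Proof. by move=> x Ix; exists 0%N; exact: mem_frobenius_power. Qed.

Lemma frobenius_power_mul e a I g z : a g -> frobenius_power p e I z ->
  frobenius_power p e (ideal_mul a I) (g ^+ (p ^ e) * z).
Proof.
move=> ag; apply: (ideal_gen_sub (is_ideal_mull_preim _ (is_ideal_gen _))).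
move=> _ [r Ir <-] /=; rewrite -exprMn; apply: mem_frobenius_power.
exact: mem_ideal_mul.
Qed.

(** One half of [(a I)^[q] = a^[q] I^[q]], combined with
    [a^[q] * a ^ (n - q) <= a ^ n]. *)
Lemma ideal_exp_sub_frobenius_mul e a I n z w :
  ideal_exp a (n - p ^ e) z -> frobenius_power p e (ideal_mul a I) w ->
  ideal_mul (ideal_exp a n) (frobenius_power p e I) (z * w).
Proof.
move=> az; have Mi := is_ideal_mul (ideal_exp a n) (frobenius_power p e I).
apply: (ideal_gen_sub (is_ideal_mull_preim _ Mi)) => _ [u aIu <-] /=.
move: u aIu; apply: ideal_mul_sub.
  exact: is_ideal_frobenius_preim (is_ideal_mull_preim _ Mi).
move=> x y ax Iy /=; rewrite exprMn mulrA [z * _]mulrC.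
apply: mem_ideal_mul; last exact: mem_frobenius_power.
exact: mem_ideal_exp_subM.
Qed.

(** The other half: [a ^ n <= a^[q] * a ^ (n - q)] by pigeonhole. *)
Lemma ideal_exp_frobenius_mul_sub e (s : seq R) I n :
  let a := ideal_gen [set` s] in (size s * (p ^ e).-1 < n)%N ->
  ideal_mul (ideal_exp a n) (frobenius_power p e I) `<=`
  ideal_mul (ideal_exp a (n - p ^ e)) (frobenius_power p e (ideal_mul a I)).
Proof.
move=> a lt_n; set M := (X in _ `<=` X).
have Mi : is_ideal M by exact: is_ideal_mul.
apply: ideal_mul_sub => // x y ax Iy; rewrite mulrC; move: x ax.
apply: ideal_exp_pigeonhole lt_n _; first exact: is_ideal_mull_preim.
move=> g z gs az /=; rewrite mulrA mulrC [y * _]mulrC.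
apply: mem_ideal_mul => //; apply: frobenius_power_mul => //.
exact: mem_ideal_gen.
Qed.

End Frobenius.

(** * The closures *)

Lemma near_ooP (P : nat -> Prop) :
  (\forall e \near \oo, P e) <-> exists N, forall e, (N <= e)%N -> P e.
Proof. by split=> [[N _ NP]|[N NP]]; exists N. Qed.

Section Closures.
Context {K : realType} {R : comNzRingType} {p : nat} (charRp : p \in [pchar R]).
Implicit Types (I J a : set R) (t : K) (e : nat) (C : nat -> set R).

Let p_gt0 : (0 < p)%N. Proof. exact/prime_gt0/(pcharf_prime charRp). Qed.

(** Passing from [t] to [t - 1] lowers the exponent by exactly [q]; the
    truncation of natural subtraction reflects that a non-positive power is
    the whole ring. *)
Lemma ceil_powerE t e : 0 < t -> exists n : nat,
  [/\ t * (p ^ e)%:R <= n%:R,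
      forall a, ceil_power p a t e = ideal_exp a n &
      forall a, ceil_power p a (t - 1) e = ideal_exp a (n - p ^ e)].
Proof.
move=> t0; rewrite /ceil_power.
have tq0 : 0 <= t * (p ^ e)%:R by rewrite mulr_ge0 // ltW.
have : 0 <= Num.ceil (t * (p ^ e)%:R).
  by rewrite ceil_ge0 (lt_le_trans _ tq0) ?ltrN10.
case En: (Num.ceil _) => [n|//] _; exists n; split=> //.
  by have := ceil_ge (t * (p ^ e)%:R); rewrite En.
move=> a; rewrite mulrBl mul1r.
have -> : Num.ceil (t * (p ^ e)%:R - (p ^ e)%:R) = n%:Z - (p ^ e)%:Z.
  rewrite ceilDrz ?rpredN ?natr_int // En; congr (_ + _).
  by rewrite -[(p ^ e)%:R]/((p ^ e)%:Z%:~R) -mulrNz intrKceil.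
have [le_qn|lt_nq] := leqP (p ^ e) n; first by rewrite subzn.
rewrite (eqP (ltnW lt_nq)) /=.
by rewrite -opprB subzn 1?ltnW //; case: (p ^ e - n)%N (subn_gt0 n (p ^ e)).
Qed.

Lemma ceil_power1 a e : ceil_power p a (1 : K) e = ideal_exp a (p ^ e).
Proof.
by rewrite /ceil_power mul1r -[(p ^ e)%:R]/((p ^ e)%:Z%:~R) intrKceil.
Qed.

(** Common shape of the two closures: [C e] is [I^[q]] for the one of Hara and
    Yoshida, and [a ^ n * I^[q]] for the one of Vraciu. *)
Definition eventual_closure a t C : set R :=
  [set x | \forall e \near \oo,
     [set x ^+ (p ^ e) * y | y in ceil_power p a t e] `<=` C e].

Lemma eventual_closureP a t C x : eventual_closure a t C x <->
  exists N, forall e, (N <= e)%N ->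
    forall y, ceil_power p a t e y -> C e (x ^+ (p ^ e) * y).
Proof.
split=> [/near_ooP[N NC]|[N NC]].
  by exists N => e Ne y ay; apply: (NC e Ne); exists y.
by apply/near_ooP; exists N => e Ne _ [y ay <-]; exact: NC.
Qed.

Lemma hy_closure1_sub a I :
  hy_closure p a (1 : K) I `<=` ideal_colon (frobenius_closure p I) a.
Proof.
move=> x /eventual_closureP[N xN] y ay; exists N; rewrite exprMn.
apply: xN => //; rewrite ceil_power1 -[y ^+ _]mulr1.
by apply: mem_ideal_exp_subM; rewrite ?subnn.
Qed.

Lemma hy_closure1_principal f I :
  hy_closure p (ideal_gen [set f]) (1 : K) I =
  ideal_colon (frobenius_closure p I) (ideal_gen [set f]).
Proof.
apply/seteqP; split=> [|x]; first exact: hy_closure1_sub.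
move=> /colon_gen1P -/(_ (is_ideal_frobenius_closure charRp I)).
move=> /(frobenius_closureP charRp)[N xN].
apply/eventual_closureP; exists N => e Ne y.
rewrite ceil_power1 => /ideal_exp_gen1P[r ->].
rewrite mulrCA -exprMn; apply: (idealMl r (is_ideal_gen _)).
exact: xN.
Qed.

(** If the closure were idempotent at [I], then multiplication by [f] could
    not move an element outside [(I^F : f)] into it, so a power of [f] in
    [I] would force [1] into [(I^F : f)]. *)
Lemma hy_closure1_not_idempotent f I :
  ideal_radical I f -> ~ frobenius_closure p I f ->
  hy_closure p (ideal_gen [set f]) (1 : K)
    (hy_closure p (ideal_gen [set f]) (1 : K) I)
  <> hy_closure p (ideal_gen [set f]) (1 : K) I.
Proof.
move=> [n Ifn] IFf; rewrite !hy_closure1_principal.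
set J := ideal_colon (frobenius_closure p I) _ => JE.
have Fi := is_ideal_frobenius_closure charRp I.
have Ji : is_ideal J by exact: is_ideal_colon.
have Jdiv x : J (x * f) -> J x.
  move=> Jxf; rewrite -JE; apply/colon_gen1P; last exact: sub_frobenius_closure.
  exact: is_ideal_frobenius_closure.
have {Ifn} : J (f ^+ n).
  apply/colon_gen1P => //; apply: idealMr => //.
  exact: sub_frobenius_closure.
elim: n => [|n IHn]; last by rewrite exprSr => /Jdiv.
by move=> /colon_gen1P -/(_ Fi); rewrite mul1r.
Qed.

(** Regularity of [f] allows [f ^ n] to be cancelled from
    [x ^ q * f ^ n = f ^ n * j] with [j] in [I^[q]]. *)
Lemma vraciu_closure_principal f t I : 0 < t -> GRing.lreg f ->
  vraciu_closure p (ideal_gen [set f]) t I = frobenius_closure p I.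
Proof.
move=> t0 regf; apply/seteqP; split=> x.
  move=> /eventual_closureP[N xN]; exists N.
  have [n [_ /(_ (ideal_gen [set f])) an _]] := ceil_powerE N t0.
  have Pi := is_ideal_gen [set r ^+ (p ^ N) | r in I].
  have fnI : ideal_mul (ideal_exp (ideal_gen [set f]) n) (frobenius_power p N I)
      `<=` [set z | exists2 j, frobenius_power p N I j & z = f ^+ n * j].
    apply: ideal_mul_sub; last first.
      move=> y z /ideal_exp_gen1P[r ->] Iz; exists (r * z).
        exact: (idealMl r Pi).
      by rewrite mulrCA mulrA.
    split=> [|_ _ [y Iy ->] [z Iz ->]|r _ [y Iy ->]].
    - by exists 0; rewrite ?mulr0 //; exact: (ideal0 Pi).
    - by exists (y + z); rewrite ?mulrDr //; case: Pi => _ + _; apply.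
    - by exists (r * y); rewrite 1?mulrCA //; exact: (idealMl r Pi).
  have := xN N (leqnn N) (f ^+ n); rewrite an => /(_ _)/fnI[].
    by apply/ideal_exp_gen1P; exists 1; rewrite mul1r.
  by move=> j Ij; rewrite mulrC => /(@lregX _ f n regf)->.
move=> /(frobenius_closureP charRp)[N xN].
apply/eventual_closureP; exists N => e Ne y ay; rewrite mulrC.
by apply: mem_ideal_mul => //; exact: xN.
Qed.

Lemma size_mul_lt_exponent m n e t : m%:R < t -> t * (p ^ e)%:R <= n%:R ->
  (m * (p ^ e).-1 < n)%N.
Proof.
move=> mt tn; apply: (@leq_ltn_trans (m * p ^ e)).
  by rewrite leq_mul2l leq_pred orbT.
rewrite -(ltr_nat K) natrM; apply: lt_le_trans tn.
by rewrite ltr_pM2r // ltr0n expn_gt0 p_gt0.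
Qed.

(** The condition on the right-hand side holds from some [e] on that depends
    on the element of [a]; finitely many generators have a common bound, and
    by pigeonhole they suffice. *)
Lemma eventual_closure_colon (s : seq R) t C :
  let a := ideal_gen [set` s] in
  (forall e, is_ideal (C e)) -> (size s)%:R < t ->
  eventual_closure a t C = ideal_colon (eventual_closure a (t - 1) C) a.
Proof.
move=> a Ci st; have t0 : 0 < t by apply: le_lt_trans st; rewrite ler0n.
apply/seteqP; split=> x.
  move=> /eventual_closureP[N xN] y ay.
  apply/eventual_closureP; exists N => e Ne z.
  have [n [_ an an1]] := ceil_powerE e t0; rewrite an1 => az.
  rewrite exprMn -mulrA; apply: xN => //; rewrite an.
  exact: mem_ideal_exp_subM.
move=> xa; have [|N xN] := @bounded_exponents _ s (fun g e =>
    forall y, ceil_power p a (t - 1) e y -> C e ((x * g) ^+ (p ^ e) * y)).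
  by move=> g gs; apply/eventual_closureP/xa; exact: mem_ideal_gen.
apply/eventual_closureP; exists N => e Ne y.
have [n [tn an an1]] := ceil_powerE e t0; rewrite an; move: y.
apply: (ideal_exp_pigeonhole (is_ideal_mull_preim _ (Ci e))).
  exact: size_mul_lt_exponent tn.
move=> g z gs az /=; rewrite mulrA -exprMn; apply: xN => //.
by rewrite an1.
Qed.

Lemma hy_closure_colon (s : seq R) t I :
  let a := ideal_gen [set` s] in (size s)%:R < t ->
  hy_closure p a t I = ideal_colon (hy_closure p a (t - 1) I) a.
Proof. by apply: eventual_closure_colon => e; exact: is_ideal_gen. Qed.

(** By pigeonhole [a ^ n * I^[q] = a ^ (n - q) * (a I)^[q]], so both sides are
    closures with respect to the same family of ideals. *)
Lemma vraciu_closure_colon (s : seq R) t I :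
  let a := ideal_gen [set` s] in (size s)%:R < t ->
  vraciu_closure p a t I =
  ideal_colon (vraciu_closure p a (t - 1) (ideal_mul a I)) a.
Proof.
move=> a st; have t0 : 0 < t by apply: le_lt_trans st; rewrite ler0n.
pose C e := ideal_mul (ceil_power p a t e) (frobenius_power p e I).
have CE : C = fun e => ideal_mul (ceil_power p a (t - 1) e)
                                 (frobenius_power p e (ideal_mul a I)).
  apply/funext => e; rewrite /C.
  have [n [tn an an1]] := ceil_powerE e t0; rewrite an an1.
  apply/seteqP; split.
    by apply: ideal_exp_frobenius_mul_sub; exact: size_mul_lt_exponent tn.
  apply: ideal_mul_sub => [|x y ax Iy]; first exact: is_ideal_mul.
  exact: ideal_exp_sub_frobenius_mul.
rewrite -[LHS]/(eventual_closure a t C).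
rewrite eventual_closure_colon // => [|e]; last exact: is_ideal_mul.
by rewrite CE.
Qed.

Lemma vraciu_closure_nil (s : seq R) t I :
  let a := ideal_gen [set` s] in 0 < t -> a `<=` ideal_radical [set 0] ->
  vraciu_closure p a t I = setT.
Proof.
move=> a t0 /ideal_exp_nil[N aN]; apply/seteqP; split=> // x _.
apply/eventual_closureP; exists (Num.bound (N%:R / t)) => e Ne y.
have [n [tn an _]] := ceil_powerE e t0; rewrite an => /aN -> /=.
  by rewrite mulr0; apply: ideal0; exact: is_ideal_mul.
rewrite -(ler_nat K); apply: le_trans tn; rewrite mulrC -ler_pdivrMr //.
have Nt0 : 0 <= N%:R / t by rewrite divr_ge0 // ltW.
apply: le_trans (ltW (archi_boundP Nt0)) _; rewrite ler_nat.
apply: leq_trans Ne (ltnW (ltn_expl e _)).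
exact/prime_gt1/(pcharf_prime charRp).
Qed.

End Closures.

Theorem proposition3p18 (K : realType) (R : comNzRingType) (p : nat)
    (noethR : noetherian R) (charRp : p \in [pchar R])
    (I a : set R) (idealI : is_ideal I) (ideala : is_ideal a)
    (t : K) (t_gt0 : 0 < t) :
  [/\ (* (a) *)
      [/\ hy_closure p a (1 : K) I `<=` ideal_colon (frobenius_closure p I) a,
          principal a ->
            hy_closure p a (1 : K) I = ideal_colon (frobenius_closure p I) a
        & forall (f : R) (m : set R), a = ideal_gen [set f] ->
            is_local_ring m -> primary_to m I ->
            m f -> ~ frobenius_closure p I f ->
            hy_closure p a (1 : K) (hy_closure p a (1 : K) I)
              <> hy_closure p a (1 : K) I],
      (* (b) *)
      forall f : R, a = ideal_gen [set f] -> GRing.lreg f ->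
        vraciu_closure p a t I = frobenius_closure p I,
      (* (c) *)
      (mu a)%:R < t ->
        hy_closure p a t I = ideal_colon (hy_closure p a (t - 1) I) a /\
        vraciu_closure p a t I =
          ideal_colon (vraciu_closure p a (t - 1) (ideal_mul a I)) a
    & (* (d) *)
      a `<=` ideal_radical [set 0] ->
        forall J : set R, is_ideal J -> forall s : K, 0 < s ->
          vraciu_closure p a s J = setT].
Proof.
have [gens [size_gens aE]] := mu_generators noethR ideala.
split.
- split.
  + exact: hy_closure1_sub.
  + by case=> f ->; exact: hy_closure1_principal.
  + move=> f m -> _ [_ <-]; exact: hy_closure1_not_idempotent.
- by move=> f ->; exact: vraciu_closure_principal.
- rewrite -size_gens aE => lt_t.
  by split; [exact: hy_closure_colon|exact: vraciu_closure_colon].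
- by rewrite aE => nila J _ s s0; exact: vraciu_closure_nil.
Qed.
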